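(* Let $l\in\mathbb{N}$ and let $A\subseteq\mathbb{N}$ be a dynamical $C^{\star}$-set in $(\mathbb{N},+)$. Then for any $l$ almost minimal sequences $\langle x_n^{(1)}\rangle_{n=1}^{\infty},\ldots,\langle x_n^{(l)}\rangle_{n=1}^{\infty}$ in $\mathbb{N}$, there exists, for each $i\in\{1,2,\ldots,l\}$, a sum subsystem $\langle y_n^{(i)}\rangle_{n=1}^{\infty}$ of $\langle x_n^{(i)}\rangle_{n=1}^{\infty}$ such that $$ZFS\left(\langle y_n^{(i)}\rangle_{i,n=1,1}^{l,\infty}\right)\cup ZFP\left(\langle y_n^{(i)}\rangle_{i,n=1,1}^{l,\infty}\right)\subseteq A.$$
   Context: $\mathbb{N}$ is the set of positive integers and $\mathcal{P}_f(\mathbb{N})$ is the set of nonempty finite subsets of $\mathbb{N}$. Measure preserving system: a quadruple $(X,\mathcal{B},\mu,T)$ where $(X,\mathcal{B},\mu)$ is a probability space and $T:X\to X$ satisfies $T^{-1}B\in\mathcal{B}$ and $\mu(T^{-1}B)=\mu(B)$ for all $B\in\mathcal{B}$; $T^{-n}B$ denotes the preimage of $B$ under $T^n$. $\beta\mathbb{N}$ is the set of ultrafilters on $\mathbb{N}$ (Stone–Čech compactification), with $A\in p+q$ iff $\{x\in\mathbb{N}:-x+A\in q\}\in p$, where $-x+A=\{y\in\mathbb{N}:x+y\in A\}$; $K(\beta\mathbb{N})$ is its smallest two-sided ideal. A set is central if it belongs to some idempotent $p=p+p$ in $K(\beta\mathbb{N})$, and central$^{\star}$ if it meets every central set. The system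 is weak mixing iff for every $\epsilon>0$ and $A,B\in\mathcal{B}$ the set $\{n\in\mathbb{N}:|\mu(A\cap T^{-n}B)-\mu(A)\mu(B)|<\epsilon\}$ is central$^{\star}$. A set $A\subseteq\mathbb{N}$ is a dynamical $C^{\star}$-set if there exist a weak mixing system $(X,\mathcal{B},\mu,T)$ and $A_0,A_1\in\mathcal{B}$ with $\mu(A_0)\mu(A_1)>0$ such that $\{n\in\mathbb{N}:\mu(A_0\cap T^{-n}A_1)>0\}\subseteq A$. A set $A\subseteq\mathbb{N}$ is a $J$-set if for every nonempty finite set $F$ of functions $\mathbb{N}\to\mathbb{N}$ there exist $a\in\mathbb{N}$ and $H\in\mathcal{P}_f(\mathbb{N})$ such that $a+\sum_{n\in H}f(n)\in A$ for each $f\in F$. $J(\mathbb{N})=\{p\in\beta\mathbb{N}:\text{every }A\in p\text{ is a }J\text{-set}\}$. For a sequence $\langle x_n\rangle$ in $\mathbb{N}$, $FS(\langle x_n\rangle_{n=m}^\infty)=\{\sum_{n\in F}x_n:F\in\mathcal{P}_f(\mathbb{N}),\ \min F\ge m\}$. The sequence $\langle x_n\rangle_{n=1}^{\infty}$ is almost minimal if $\left(\bigcap_{m=1}^{\infty}\mathrm{cl}\left(FS(\langle x_n\rangle_{n=m}^{\infty})\right)\right)\cap J(\mathbb{N})\neq\emptyset$, where $\mathrm{cl}(A)=\{p\in\beta\mathbb{N}:A\in p\}$. A sum subsystem of $\langle x_n\rangle_{n=1}^\infty$ is a sequence $\langle y_n\rangle_{n=1}^\infty$ for which there is a sequence $\langle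 H_n\rangle_{n=1}^\infty$ in $\mathcal{P}_f(\mathbb{N})$ with $\max H_n<\min H_{n+1}$ and $y_n=\sum_{t\in H_n}x_t$ for all $n\in\mathbb{N}$. For $l$ sequences $\langle x_n^{(1)}\rangle,\ldots,\langle x_n^{(l)}\rangle$ in $\mathbb{N}$: $ZFS(\langle x_n^{(i)}\rangle_{i,n=1,1}^{l,\infty})=\{\sum_{t\in H}y_t:H\in\mathcal{P}_f(\mathbb{N})\text{ and }y_j\in\{x_j^{(1)},\ldots,x_j^{(l)}\}\text{ for every }j\in\mathbb{N}\}$, and $ZFP(\langle x_n^{(i)}\rangle_{i,n=1,1}^{l,\infty})=\{\prod_{t\in H}y_t:H\in\mathcal{P}_f(\mathbb{N})\text{ and }y_j\in\{x_j^{(1)},\ldots,x_j^{(l)}\}\text{ for every }j\in\mathbb{N}\}$. *)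

(* Defs.v *)
From HB Require Import structures.
From mathcomp Require Import all_boot all_order all_algebra finmap.
From mathcomp Require Import all_classical all_reals all_analysis.

Set Implicit Arguments.
Unset Strict Implicit.
Unset Printing Implicit Defensive.

Import Order.TTheory GRing.Theory Num.Theory.

Local Open Scope classical_set_scope.
Local Open Scope nat_scope.

(* The semigroup N of positive integers is the subset [Npos] of [nat]: subsets
   of N are sets [A `<=` Npos], and a sequence <x_n>_{n >= 1} in N is a map
   [x : nat -> nat] sending [Npos] to [Npos]; its value at 0 is never used. *)
Definition Npos : set nat := [set n | 0 < n].

Definition Pf : set {fset nat} := [set H | H != fset0 /\ [set` H] `<=` Npos].

(* An ultrafilter on N is identified with its image on [nat], that is, with an
   ultrafilter on [nat] that contains [Npos]. *)
Definition betaN : set (set_system nat) :=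
  [set p | UltraFilter p /\ p Npos].

(* [neg_translate x A] is [-x + A]. *)
Definition neg_translate (x : nat) (A : set nat) : set nat :=
  [set y | Npos y /\ A (x + y)].

Definition bplus (p q : set_system nat) : set_system nat :=
  [set A | p [set x | Npos x /\ q (neg_translate x A)]].

Definition two_sided_ideal (I : set (set_system nat)) : Prop :=
  [/\ I !=set0, I `<=` betaN &
      forall p q, betaN p -> I q -> I (bplus p q) /\ I (bplus q p)].

(* The smallest two-sided ideal exists, hence it is the intersection of all of
   them. *)
Definition KbetaN : set (set_system nat) := smallest two_sided_ideal set0.

Definition central (A : set nat) : Prop :=
  A `<=` Npos /\ exists p, [/\ KbetaN p, bplus p p = p & p A].

Definition central_star (A : set nat) : Prop :=
  A `<=` Npos /\ forall B, central B -> A `&` B !=set0.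

Section Systems.
Context {R : realType} {d : measure_display} {X : measurableType d}.
Variables (mu : probability X R) (T : X -> X).

Definition measure_preserving : Prop :=
  measurable_fun setT T /\
  forall B, measurable B -> mu (T @^-1` B) = mu B.

(* Weak mixing in the sense of convergence of [mu (A `&` T^-n B)] to
   [mu A * mu B] along central-star sets of times [n]. *)
Definition weak_mixing : Prop :=
  measure_preserving /\
  forall (eps : R) (A B : set X), (0 < eps)%R -> measurable A -> measurable B ->
    central_star [set n | Npos n /\
      (`| mu (A `&` iter n T @^-1` B) - mu A * mu B | < eps%:E)%E].

End Systems.

Definition dynamical_Cstar (R : realType) (A : set nat) : Prop :=
  A `<=` Npos /\
  exists (d : measure_display) (X : measurableType d) (mu : probability X R)
         (T : X -> X) (A0 A1 : set X),
    [/\ weak_mixing mu T, measurable A0, measurable A1,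
        (0 < mu A0 * mu A1)%E &
        [set n | Npos n /\ (0 < mu (A0 `&` iter n T @^-1` A1))%E] `<=` A].

Definition J_set (A : set nat) : Prop :=
  forall F : set (nat -> nat),
    finite_set F -> F !=set0 -> (forall f, F f -> set_fun Npos Npos f) ->
    exists (a : nat) (H : {fset nat}),
      [/\ Npos a, Pf H & forall f, F f -> A (a + \sum_(n <- H) f n)].

Definition JbetaN : set (set_system nat) :=
  [set p | betaN p /\ forall A, A `<=` Npos -> p A -> J_set A].

Definition FS (x : nat -> nat) (m : nat) : set nat :=
  [set \sum_(n <- H) x n | H in
     [set H : {fset nat} | Pf H /\ forall n, n \in H -> m <= n]].

Definition cl (A : set nat) : set (set_system nat) :=
  [set p | betaN p /\ p A].

Definition almost_minimal (x : nat -> nat) : Prop :=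
  (\bigcap_(m in Npos) cl (FS x m)) `&` JbetaN !=set0.

(* [max (H n) < min (H n.+1)] is spelled out elementwise, both sets being
   nonempty. *)
Definition sum_subsystem (x y : nat -> nat) : Prop :=
  exists H : nat -> {fset nat}, forall n, Npos n ->
    [/\ Pf (H n),
        forall i j, i \in H n -> j \in H n.+1 -> i < j &
        y n = \sum_(t <- H n) x t].

Definition selection (l : nat) (x : 'I_l -> nat -> nat) (y : nat -> nat) : Prop :=
  forall j, Npos j -> exists i : 'I_l, y j = x i j.

Definition ZFS (l : nat) (x : 'I_l -> nat -> nat) : set nat :=
  [set s | exists (H : {fset nat}) (y : nat -> nat),
     [/\ Pf H, selection x y & s = \sum_(t <- H) y t]].

Definition ZFP (l : nat) (x : 'I_l -> nat -> nat) : set nat :=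
  [set s | exists (H : {fset nat}) (y : nat -> nat),
     [/\ Pf H, selection x y & s = \prod_(t <- H) y t]].

(* Main.v *)
(* Let [p] be in J(N).  For all [s >= 0] and [t > 0] the set
   [n | A (s + t * n)] is in [p]: otherwise, with [A0], [A1] the sets witnessing
   that [A] is a dynamical C*-set, the set of [n] with
   [mu (A0 `&` T^-(s + t n) A1) = 0] is a J-set.  A minimal idempotent and weak
   mixing give functions [f 1, ..., f m] such that for every [H] the sets
   [T^-(s + t (c + \sum_(n <- H) f i n)) A1] are pairwise nearly independent,
   whatever [c] is.  The J-set property makes all of them almost disjoint from
   [A0], which contradicts a second moment estimate once [m] is large.
   The sum subsystems are then built greedily: at each stage finitely many
   conditions [s + y \in A] and [t * y \in A], for the sums [s] and products [t]
   obtained so far, hold for some [y] in [FS (x i) k], as all these sets belong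
   to one ultrafilter in J(N). *)
Require Import Defs.
From HB Require Import structures.
From mathcomp Require Import all_boot all_order all_algebra finmap.
From mathcomp Require Import all_classical all_reals all_analysis.
From mathcomp Require Import measurable_realfun ring lra.

Set Implicit Arguments.
Unset Strict Implicit.
Unset Printing Implicit Defensive.

Import Order.TTheory GRing.Theory Num.Theory.

Local Open Scope classical_set_scope.
Local Open Scope nat_scope.

(** * Zorn's lemma, and filters as closed subsets of [betaN] *)

(** [Zorn_bigcup] also tests the empty chain, where [P] may fail; for the sets whose union with [F0]
    satisfies [P], that case is [PF0]. *)
Lemma maximal_above (T : Type) (P : set (set T)) (F0 : set T) :
  P F0 ->
  (forall C : set (set T), C !=set0 -> C `<=` P -> total_on C subset ->
    P (\bigcup_(X in C) X)) ->
  exists A, [/\ F0 `<=` A, P A & forall B, P B -> A `<=` B -> B = A].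
Proof.
move=> PF0 Pchain.
have [C CP Ctot|A [PA Amax]] := @Zorn_bigcup T [set X | P (F0 `|` X)].
  have [->|/set0P[X CX]] := eqVneq C set0; first by rewrite /= bigcup_set0 setU0.
  rewrite /= -bigcupUr; last by exists X.
  rewrite -(bigcup_image C (setU F0) id); apply: Pchain.
  - by exists (F0 `|` X), X.
  - by move=> _ [Y CY <-]; exact: CP.
  - move=> _ _ [Y CY <-] [Z CZ <-].
    by have [YZ|ZY] := Ctot _ _ CY CZ; [left|right]; exact: setUS.
exists (F0 `|` A); split=> [|//|B PB FAB]; first exact: subsetUl.
have AB : A `<=` B by move=> z Az; apply: FAB; right.
have BA : B `<=` A.
  apply: contrapT => nBA; apply: (Amax B); first by split.
  rewrite /= (_ : F0 `|` B = B)//.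
  by apply/setUidPr => z Fz; apply: FAB; left.
by apply/seteqP; split=> // z /BA; right.
Qed.

(** Stands for the nonempty closed set of ultrafilters above [F]; maximal filters then play the part
    of minimal closed sets. *)
Definition pfilter (F : set_system nat) := ProperFilter F /\ F Npos.

Lemma betaN_pfilter p : betaN p -> pfilter p.
Proof. by case=> pU pN; split=> //; exact: ultra_proper. Qed.

Lemma pfilter_chain (C : set (set_system nat)) :
  C !=set0 -> (forall F, C F -> pfilter F) -> total_on C subset ->
  pfilter (\bigcup_(F in C) F).
Proof.
move=> [F0 CF0] CP Ctot; split; last by exists F0 => //; case: (CP _ CF0).
split.
  by move=> [F CF]; case: (CP _ CF) => FF _; exact: filter_not_empty.
split.
- by exists F0 => //; case: (CP _ CF0) => FF _; exact: filterT.
- move=> A B [F CF FA] [G CG GB].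
  have [FG|GF] := Ctot _ _ CF CG.
    by exists G => //; case: (CP _ CG) => GF _; apply: filterI => //; exact: FG.
  by exists F => //; case: (CP _ CF) => FF _; apply: filterI => //; exact: GF.
- move=> A B AB [F CF FA]; exists F => //.
  by case: (CP _ CF) => FF _; exact: filterS FA.
Qed.

Lemma betaN_above F : pfilter F -> exists p, betaN p /\ F `<=` p.
Proof.
move=> [FF FN]; have [p [pU Fp]] := ultraFilterLemma FF.
by exists p; split=> //; split=> //; exact: Fp.
Qed.

Lemma betaN_eq p q : betaN p -> betaN q -> p `<=` q -> p = q.
Proof. by move=> [pU _] [qU _] pq; rewrite (@max_filter _ p pU q). Qed.

Lemma betaN_setC p A : betaN p -> ~ p A -> p (~` A).
Proof. by move=> [pU _] npA; have [] := in_ultra_setVsetC A pU. Qed.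

Lemma betaN_not_setC p A : betaN p -> p A -> ~ p (~` A).
Proof.
move=> [pU _] pA pCA; apply: (@filter_not_empty _ p _).
by rewrite -(setICr A); exact: filterI.
Qed.

Lemma pfilter_betaN F : pfilter F -> (forall A, F A \/ F (~` A)) -> betaN F.
Proof.
move=> [FF FN] Fd; split=> //; split=> // G GF FG; apply/seteqP; split=> // A GA.
have [//|FCA] := Fd A; exfalso; apply: (@filter_not_empty _ G _).
by rewrite -(setICr A); apply: filterI => //; exact: FG.
Qed.

(** * Addition of filters and the existence of idempotents *)

Lemma neg_translateI x A B :
  neg_translate x (A `&` B) = neg_translate x A `&` neg_translate x B.
Proof. by apply/seteqP; split=> y /= => [[? [? ?]]|[[? ?] [? ?]]]. Qed.

Lemma neg_translateS x A B :
  A `<=` B -> neg_translate x A `<=` neg_translate x B.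
Proof. by move=> AB y [y0 /AB]. Qed.

Lemma neg_translateN x : 0 < x -> neg_translate x Npos = Npos.
Proof.
move=> x0; apply/seteqP; split=> y; first by case.
by move=> y0; split => //; rewrite /Npos /= addn_gt0 x0.
Qed.

Lemma neg_translateA x y A : 0 < x -> 0 < y ->
  neg_translate y (neg_translate x A) = neg_translate (x + y) A.
Proof.
move=> x0 y0; apply/seteqP; split=> z /=.
  by move=> [z0 [_]]; rewrite addnA.
by move=> [z0 Az]; split=> //; split; rewrite ?addnA// /Npos /= addn_gt0 y0.
Qed.

(** Filters are allowed because, for an ultrafilter [q], [bplus F q] is the filter of the closed set
    of all [bplus p q] with [p] above [F]. *)
Lemma bplus_pfilter p q : pfilter p -> pfilter q -> pfilter (bplus p q).
Proof.
move=> [pF pN] [qF qN]; split; last first.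
  by apply: filterS pN => x x0; split=> //; rewrite neg_translateN.
split.
  move=> p0; apply: (@filter_not_empty _ p _); apply: (@filterS _ p _ _ _ _ p0) => x [_ q0].
  by apply: (@filter_not_empty _ q _); apply: filterS q0 => y [].
split.
- apply: filterS pN => x x0; split=> //.
  by apply: filterS qN => y y0.
- move=> A B pA pB; apply: (@filterS2 _ p _ _ _ _ _ pA pB) => x [x0 qA] [_ qB]; split=> //.
  by rewrite neg_translateI; exact: filterI.
- move=> A B AB; apply: (@filterS _ p) => x [x0 qA]; split=> //.
  by apply: filterS qA; exact: neg_translateS.
Qed.

Lemma bplus_betaN p q : betaN p -> betaN q -> betaN (bplus p q).
Proof.
move=> pb qb; apply: pfilter_betaN.
  by apply: bplus_pfilter; exact: betaN_pfilter.
move=> A; have [pA|npA] := pselect (bplus p q A); [by left|right].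
have /betaN_setC : ~ p [set x | Npos x /\ q (neg_translate x A)] := npA.
move=> /(_ pb) pCA.
case: (pb) => pU pN; case: (qb) => qU qN.
apply: filterS2 pCA pN => x nx x0; split=> //.
have /betaN_setC : ~ q (neg_translate x A) by move=> qA; exact: nx.
move=> /(_ qb) qCA; apply: filterS2 qCA qN => y ny y0; split=> // Axy.
exact: ny.
Qed.

Lemma bplusA p q r : bplus (bplus p q) r = bplus p (bplus q r).
Proof.
apply/funext => A; rewrite /bplus /=; congr p; apply/seteqP.
split=> x /= [x0]; (have -> : neg_translate x
    [set w | Npos w /\ r (neg_translate w A)] =
    [set y | Npos y /\ r (neg_translate y (neg_translate x A))]; last by []).
  apply/seteqP; split=> y /= [y0]; last first.
    by rewrite neg_translateA // => ryA; do !split=> //; rewrite /Npos/= addn_gt0 x0.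
  by move=> [_ rA]; split=> //; rewrite neg_translateA.
apply/seteqP; split=> y /= [y0]; last first.
  by rewrite neg_translateA // => ryA; do !split=> //; rewrite /Npos/= addn_gt0 x0.
by move=> [_ rA]; split=> //; rewrite neg_translateA.
Qed.

Lemma bplusSl p p' q : p `<=` p' -> bplus p q `<=` bplus p' q.
Proof. by move=> pp' A; exact: pp'. Qed.

(* The filter of the closed set of all [p] above [F] with [bplus p q] above
   [r], see [bplus_lift]. *)
Definition lift_filter (F q r : set_system nat) : set_system nat :=
  [set B | exists C A, [/\ F C, r A &
    C `&` [set x | Npos x /\ q (neg_translate x A)] `<=` B]].

(** Properness: if a generator were empty, no positive [x] in [C] would have [neg_translate x A] in
    [q], so the complement of [A] would lie in [bplus F q], hence in [r]. *)
Lemma lift_filter_pfilter F q r : pfilter F -> betaN q -> betaN r ->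
  bplus F q `<=` r -> pfilter (lift_filter F q r).
Proof.
move=> [FF FN] qb rb Fqr; case: (qb) => qU qN; case: (rb) => rU rN; split; last first.
  by exists Npos, setT; split=> [//||x []//]; exact: filterT.
split; last split.
- move=> [C [A [FC rA CA0]]]; apply: (betaN_not_setC rb rA); apply: Fqr.
  apply: filterS2 FC FN => x Cx x0; split=> //.
  have /betaN_setC : ~ q (neg_translate x A) by move=> qA; exact: (CA0 x).
  move=> /(_ qb) qCA; apply: filterS2 qCA qN => y ny y0; split=> // Axy.
  exact: ny.
- by exists setT, setT; split=> [||//]; exact: filterT.
- move=> B B' [C [A [FC rA CAB]]] [C' [A' [FC' rA' CAB']]].
  exists (C `&` C'), (A `&` A'); split; [exact: filterI|exact: filterI|].
  move=> x [[Cx C'x] [x0]]; rewrite neg_translateI => qAA'.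
  split; [apply: CAB|apply: CAB'].
    by split=> //; split=> //; apply: filterS qAA' => ? [].
  by split=> //; split=> //; apply: filterS qAA' => ? [].
- move=> B B' BB' [C [A [FC rA CAB]]]; exists C, A; split=> //.
  exact: subset_trans BB'.
Qed.

Lemma lift_filter_sub F q r : betaN r -> F `<=` lift_filter F q r.
Proof.
move=> [rU _] C FC; by exists C, setT; split=> [//||x []//]; exact: filterT.
Qed.

Lemma lift_filter_bplus F q r p : pfilter F -> betaN p -> betaN q -> betaN r ->
  lift_filter F q r `<=` p -> bplus p q = r.
Proof.
move=> [FF FN] pb qb rb Hp; apply/esym/betaN_eq => //; first exact: bplus_betaN.
move=> A rA; apply: Hp; by exists setT, A; split=> [|//|x []//]; exact: filterT.
Qed.

Lemma bplus_lift F q r : pfilter F -> betaN q -> betaN r -> bplus F q `<=` r ->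
  exists p, [/\ betaN p, F `<=` p & bplus p q = r].
Proof.
move=> Fp qb rb Fqr.
have [p [pb Hp]] := betaN_above (lift_filter_pfilter Fp qb rb Fqr).
exists p; split=> //; last exact: (lift_filter_bplus Fp).
by apply: (subset_trans _ Hp); exact: lift_filter_sub.
Qed.

(* The ultrafilters above [F] form a closed subsemigroup of betaN. *)
Definition semigroup_filter (F : set_system nat) :=
  pfilter F /\ forall q, betaN q -> F `<=` q -> F `<=` bplus F q.

(** For [u], [p] above [F], (u + q) + (p + q) = (u + (q + p)) + q, and u + (q + p) is again above
    [F]. *)
Lemma semigroup_filter_bplus F q : semigroup_filter F -> betaN q -> F `<=` q ->
  semigroup_filter (bplus F q).
Proof.
move=> [Fp Fsg] qb Fq; split; first exact/bplus_pfilter/betaN_pfilter.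
move=> r rb Fqr; have [p [pb Fp' <-]] := bplus_lift Fp qb rb Fqr.
rewrite -(bplusA (bplus F q) p q); apply: bplusSl; rewrite bplusA.
apply: (Fsg); first exact: bplus_betaN.
by apply: subset_trans (Fsg _ pb Fp') _; exact: bplusSl.
Qed.

(** If r + q = q and p + q = q, then (r + p) + q = q; that [q] is above [bplus F q] makes the set of
    such [p] nonempty. *)
Lemma semigroup_filter_lift F q : semigroup_filter F -> betaN q ->
  bplus F q `<=` q -> semigroup_filter (lift_filter F q q).
Proof.
move=> [Fp Fsg] qb Fqq; have Hp := lift_filter_pfilter Fp qb qb Fqq.
split=> // r rb Hr B [C [A [FC qA CAB]]].
have rq : bplus r q = q by exact: (lift_filter_bplus Fp).
have Fr : F `<=` r by apply: (subset_trans _ Hr); exact: lift_filter_sub.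
have [HF HN] := Hp; have [rU rN] := rb.
have HC := @lift_filter_sub F q q qb _ (Fsg r rb Fr C FC).
have HA : lift_filter F q q [set x | Npos x /\ q (neg_translate x A)].
  by exists setT, A; split=> [|//|x []//]; case: Fp => FF _; exact: filterT.
apply: (@filterS2 _ (lift_filter F q q) _ _ _ _ _ HC HA) => x [x0 rC] [_ qxA]; split=> //.
have rA : r [set y | Npos y /\ q (neg_translate y (neg_translate x A))].
  by move: qxA; rewrite -{1}rq.
apply: filterS2 rC rA => y [y0 Cy] [_ qxy]; split=> //; apply: CAB; split=> //.
by split; [rewrite /Npos /= addn_gt0 x0|rewrite -neg_translateA].
Qed.

Lemma semigroup_filter_chain (C : set (set_system nat)) :
  C !=set0 -> C `<=` semigroup_filter -> total_on C subset ->
  semigroup_filter (\bigcup_(F in C) F).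
Proof.
move=> C0 CP Ctot; split; first by apply: pfilter_chain => // F /CP[].
move=> q qb Cq A [F CF FA]; have [[FF FN] Fsg] := CP _ CF.
have Fq : F `<=` q by move=> B FB; apply: Cq; exists F.
by exists F => //; exact: (Fsg q qb Fq).
Qed.

(* Ellis: by maximality of [F], minimality of its closed semigroup gives
   [bplus F q = F] and then [{p | p + q = q}] is again the whole semigroup. *)
Lemma semigroup_filter_idempotent F0 : semigroup_filter F0 ->
  exists p, [/\ betaN p, F0 `<=` p & bplus p p = p].
Proof.
move=> F0sg; have [F [F0F Fsg Fmax]] :=
  maximal_above F0sg semigroup_filter_chain.
have [Fp Fb] := Fsg; have [q [qb Fq]] := betaN_above Fp.
have FFq : bplus F q = F.
  by apply: Fmax; [exact: semigroup_filter_bplus|exact: Fb].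
have LF : lift_filter F q q = F.
  apply: Fmax; last exact: lift_filter_sub.
  by apply: semigroup_filter_lift => //; rewrite FFq.
exists q; split=> //; first exact: subset_trans Fq.
by apply: (lift_filter_bplus Fp) => //; rewrite LF.
Qed.

(** * Closed left ideals and a minimal idempotent *)

(** The filter form of a closed left ideal: if [q] is above [F], so is [bplus u q] for every [u] in
    [betaN]. *)
Definition translation_invariant (F : set_system nat) :=
  pfilter F /\ forall A x, Npos x -> F A -> F (neg_translate x A).

(** The filter of all of [betaN]; [bplus principal_Npos q] is that of the left ideal betaN + q. *)
Definition principal_Npos : set_system nat := [set A | Npos `<=` A].

Lemma principal_Npos_pfilter : pfilter principal_Npos.
Proof.
split; last by [].
split; first by move=> /(_ 1 isT).
split=> //.
- by move=> A B HA HB x x0; split; [exact: HA|exact: HB].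
- by move=> A B AB HA x x0; apply: AB; exact: HA.
Qed.

Lemma translation_invariant_sub F q : translation_invariant F -> F `<=` q ->
  F `<=` bplus principal_Npos q.
Proof. by move=> [_ FT] Fq A FA x x0; split=> //; exact/Fq/FT. Qed.

Lemma principal_bplus_invariant q : betaN q ->
  translation_invariant (bplus principal_Npos q).
Proof.
move=> qb; split.
  apply: bplus_pfilter; [exact: principal_Npos_pfilter|exact: betaN_pfilter].
move=> A x x0 qA y y0; split=> //; rewrite neg_translateA //.
by apply: (qA (x + y) _).2; rewrite /Npos /= addn_gt0 x0.
Qed.

Lemma translation_invariant_semigroup F : translation_invariant F ->
  semigroup_filter F.
Proof.
move=> FT; have [[FF FN] _] := FT; split=> // q qb Fq.
apply: subset_trans (translation_invariant_sub FT Fq) _.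
by apply: bplusSl => A NA; exact: filterS FN.
Qed.

Lemma translation_invariant_chain (C : set (set_system nat)) :
  C !=set0 -> C `<=` translation_invariant -> total_on C subset ->
  translation_invariant (\bigcup_(F in C) F).
Proof.
move=> C0 CP Ctot; split; first by apply: pfilter_chain => // F /CP[].
by move=> A x x0 [F CF FA]; exists F => //; apply: (CP _ CF).2.
Qed.

(* The ultrafilters above a maximal translation invariant filter form a minimal
   left ideal, which is contained in every two-sided ideal. *)
Lemma minimal_idempotent : exists p, [/\ betaN p, KbetaN p & bplus p p = p].
Proof.
have NT : translation_invariant principal_Npos.
  split; first exact: principal_Npos_pfilter.
  by move=> A x x0 NA y y0; split=> //; apply: NA; rewrite /Npos /= addn_gt0 x0.
have [F [_ FT Fmax]] := maximal_above NT translation_invariant_chain.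
have Fq q : betaN q -> F `<=` q -> bplus principal_Npos q = F.
  move=> qb Fq; apply: Fmax; first exact: principal_bplus_invariant.
  exact: translation_invariant_sub.
have [p [pb Fp pp]] := semigroup_filter_idempotent (translation_invariant_semigroup FT).
exists p; split=> // I [[[i Ii] Ib Iid] _].
have Iip : I (bplus i p) := (Iid _ _ pb Ii).2.
have ib : betaN i by exact: Ib.
have Fip : F `<=` bplus i p.
  apply: subset_trans (translation_invariant_sub FT Fp) _.
  by apply: bplusSl => A NA; case: ib => iU iN; exact: filterS iN.
have ipb := bplus_betaN ib pb.
(* The left ideal betaN + (i + p) lies in the minimal one, hence equals it and contains [p]; so [p]
   has the form u + (i + p), which is in [I]. *)
have [u [ub _ <-]] : exists u, [/\ betaN u, principal_Npos `<=` u &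
    bplus u (bplus i p) = p].
  by apply: bplus_lift => //; rewrite ?Fq//; exact: principal_Npos_pfilter.
exact: (Iid _ _ ub Iip).1.
Qed.

(** * Greedy constructions of sequences from ultrafilters *)

(** [S n] holds the results over index sets below [n], the empty one included; the induction removes
    the largest index of [r]. *)
Lemma big_uniq_mem (idx : nat) (op : Monoid.com_law idx) (S : nat -> set nat)
    (w : nat -> nat) (A : set nat) :
  S 0 idx -> (forall n, S n `<=` S n.+1) ->
  (forall n s, 0 < n -> S n s -> S n.+1 (op (w n) s) /\ A (op (w n) s)) ->
  forall r, uniq r -> all (leq 1) r -> r != [::] -> A (\big[op/idx]_(k <- r) w k).
Proof.
move=> S0 SS Sw r ur rpos rn0.
suff [//] : (r != [::] -> A (\big[op/idx]_(k <- r) w k)) /\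
    S (\max_(k <- r) k).+1 (\big[op/idx]_(k <- r) w k).
  by move=> + _; exact.
have : forall k, k \in r -> k < (\max_(k <- r) k).+1.
  by move=> k kr; rewrite ltnS; exact: leq_bigmax_seq.
move: (\max_(k <- r) k).+1 => N; elim: N r ur rpos {rn0} => [|n IH] r ur rpos rn.
  have -> : r = [::].
    by case: r rn {ur rpos} => // k r /(_ k); rewrite inE eqxx => /(_ isT).
  by rewrite big_nil.
have [nr|nr] := boolP (n \in r); last first.
  have [|Ar Sr] := IH r ur rpos.
    move=> k kr; have := rn _ kr; rewrite ltnS leq_eqVlt => /predU1P[kn|//].
    by rewrite -kn kr in nr.
  by split=> //; exact: SS.
have [|||_ Sr] := IH (rem n r).
- exact: rem_uniq.
- by apply/allP => k /mem_rem kr; exact: (allP rpos).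
- move=> k; rewrite mem_rem_uniq // !inE => /andP[kn kr].
  by have := rn _ kr; rewrite ltnS leq_eqVlt (negbTE kn).
have n0 : 0 < n by exact: (allP rpos).
by rewrite (big_rem _ nr) /=; have [? ?] := Sw _ _ n0 Sr.
Qed.

Lemma filter_forall_seq (I : eqType) (T : Type) (F : set_system T)
    (P : I -> set T) (r : seq I) : Filter F ->
  (forall i, i \in r -> F (P i)) -> F [set x | forall i, i \in r -> P i x].
Proof.
move=> FF; elim: r => [_|i r IH FP]; first by apply: filterS filterT.
have Fr : F [set x | forall i, i \in r -> P i x].
  by apply: IH => j jr; apply: FP; rewrite inE jr orbT.
apply: filterS2 (FP i (mem_head _ _)) Fr => x Pix Pr j.
by rewrite inE => /predU1P[->//|]; exact: Pr.
Qed.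

(** [As] is in [p], and so is its translate by each of its elements; hence a next term that keeps
    all finite sums in [As] always exists. *)
Lemma Galvin p A : betaN p -> bplus p p = p -> p A ->
  exists z : nat -> nat, forall r, uniq r -> all (leq 1) r -> r != [::] ->
    A (\sum_(k <- r) z k).
Proof.
move=> [pU pN] pp pA.
pose As := [set x | [/\ Npos x, A x & p (neg_translate x A)]].
have pAs : p As.
  have : bplus p p A by rewrite pp.
  by apply: (@filterS2 _ p _ _ _ _ _ pA) => x Ax [].
have pAsx x : As x -> p [set y | As (x + y)].
  move=> [x0 Ax pxA].
  have : bplus p p (neg_translate x A) by rewrite pp.
  apply: (@filterS2 _ p _ _ _ _ _ pxA) => y [_ Axy] [y0].
  by rewrite neg_translateA // => ?; split=> //; rewrite /Npos /= addn_gt0 x0.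
have step (S : seq nat) : exists z, forall s, s \in S -> s = 0 \/ As s -> As (z + s).
  have /filter_ex[z Hz] : p [set z | forall s, s \in S -> s = 0 \/ As s -> As (z + s)].
    apply: filter_forall_seq => s _.
    have [s0|ns0] := pselect (s = 0 \/ As s); last by apply: filterS filterT.
    case: s0 => [->|As_s]; first by apply: filterS pAs => z Az _; rewrite addn0.
    by apply: filterS (pAsx _ As_s) => z; rewrite /= addnC.
  by exists z.
have [g Hg] := choice step.
(* [st n] lists the sums over all sets of indices below [n], with 0 for the empty set. *)
pose st := fix st n := if n is n'.+1 then
  st n' ++ [seq g (st n') + s | s <- st n'] else [:: 0].
exists (fun n => g (st n)) => r ur rpos rn0.
suff [] : As (\sum_(k <- r) g (st k)) by [].
apply: (big_uniq_mem (S := fun n => [set s | s \in st n /\ (s = 0 \/ As s)])) => //.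
- by split; [rewrite inE|left].
- by move=> n s [sn Hs]; split=> //=; rewrite mem_cat sn.
- move=> n s _ [sn Hs]; have Az := Hg _ _ sn Hs; split=> //; split; last by right.
  by rewrite /= mem_cat; apply/orP; right; apply/mapP; exists s.
Qed.

(** A residue class in [p] contains some [x] and, for [p]-many [y], also [x + y]; all these [y] are
    multiples of [t]. *)
Lemma idempotent_multiples p t : betaN p -> bplus p p = p -> 0 < t ->
  p [set n | t %| n].
Proof.
move=> pb pp t0; have [pU pN] := pb.
have [c pc] : exists c, p [set n | n %% t = c].
  apply: contrapT => nc; apply: (@filter_not_empty _ p _).
  have : p [set n | forall c, c \in iota 0 t -> n %% t <> c].
    apply: filter_forall_seq => c _; apply: (betaN_setC pb) => pc.
    by apply: nc; exists c.
  apply: filterS => n /(_ (n %% t)); rewrite mem_iota leq0n ltn_mod t0 /=.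
  exact.
have : bplus p p [set n | n %% t = c] by rewrite pp.
move=> /(@filterI _ p _ _ _ pc)/filter_ex[x [xc [x0 px]]].
apply: filterS px => y [_ /= xyc].
have : x + y == x + 0 %[mod t] by rewrite addn0 xc xyc.
by rewrite eqn_modDl mod0n.
Qed.

(** Take [z] with all finite sums in [D] and cut it into blocks of length [m]; [f i n] adds the
    first [i.+1] terms of block [n], divided by [t]. Then [t * d] is a sum of distinct terms of [z],
    whatever [H] is. *)
Lemma difference_functions p D t m : betaN p -> bplus p p = p -> p D ->
  0 < t -> exists f : 'I_m -> nat -> nat,
    (forall i, set_fun Npos Npos (f i)) /\
    forall H (i j : 'I_m), Pf H -> i < j -> exists d,
      \sum_(n <- H) f j n = \sum_(n <- H) f i n + d /\ D (t * d).
Proof.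
move=> pb pp pD t0; have [pU pN] := pb.
have [z Hz] : exists z, forall r, uniq r -> all (leq 1) r -> r != [::] ->
    (Npos `&` D `&` [set n | t %| n]) (\sum_(k <- r) z k).
  apply: (Galvin pb pp); apply: filterI; first exact: filterI.
  exact: idempotent_multiples.
have zt k : 0 < k -> 0 < z k /\ t %| z k.
  move=> k0; have := Hz [:: k]; rewrite /= k0 big_seq1.
  by move=> /(_ isT isT isT) [[]].
exists (fun i n => \sum_(k <- iota 0 i.+1) z (n * m + k) %/ t).
split=> [i n n0|H i j [H0 HN] ij].
  rewrite /Npos /= big_cons addn_gt0 addn0 divn_gt0 //.
  have /zt[z0 zt0] : 0 < n * m by rewrite muln_gt0 n0 (leq_ltn_trans _ (ltn_ord i)).
  by rewrite dvdn_leq.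
pose r := [seq n * m + k | n <- H, k <- iota i.+1 (j - i)].
have m0 : 0 < m by rewrite (leq_ltn_trans _ (ltn_ord i)).
have rpos : all (leq 1) r.
  apply/allP => _ /allpairsP[[n k] /= [nH _ ->]].
  by rewrite addn_gt0 muln_gt0 m0 (HN n nH).
exists (\sum_(q <- r) z q %/ t); split.
  rewrite /r big_allpairs_dep /= -big_split /=; apply: eq_bigr => n _.
  rewrite -[LHS]/(\sum_(k <- iota 0 j.+1) z (n * m + k) %/ t).
  have -> : iota 0 j.+1 = iota 0 i.+1 ++ iota i.+1 (j - i).
    by rewrite -[in iota i.+1 _](add0n i.+1) -iotaD addSn subnKC // ltnW.
  by rewrite big_cat.
have ur : uniq r.
  apply: allpairs_uniq; [exact: fset_uniq|exact: iota_uniq|].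
  have km k : k \in iota i.+1 (j - i) -> k < m.
    by rewrite mem_iota addSn (subnKC (ltnW ij)) => /andP[_ /leq_trans]; exact.
  move=> _ _ /allpairsP[[n k] /= [_ /km k_m ->]] /allpairsP[[n' k'] /= [_ /km k'_m ->]].
  move=> E; have nn' : n = n'.
    have := congr1 (divn^~ m) E.
    by rewrite /= !divnMDl // (divn_small k_m) (divn_small k'_m) !addn0.
  by move: E; rewrite nn' => /addnI ->.
have rn0 : r != [::].
  rewrite -size_eq0 size_allpairs size_iota muln_eq0 negb_or subn_eq0 -ltnNge ij andbT.
  by rewrite cardfs_eq0.
have [[_ Dr] _] := Hz r ur rpos rn0.
rewrite big_distrr /= (_ : \sum_(q <- r) _ = \sum_(q <- r) z q) //.
rewrite big_seq [RHS]big_seq; apply: eq_bigr => q qr.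
by rewrite mulnC divnK //; apply: (zt _ _).2; exact: (allP rpos).
Qed.

(** * A second moment estimate *)

Section SecondMoment.
Context {R : realType} {d : measure_display} {X : measurableType d}.
Variable mu : probability X R.

Local Open Scope ring_scope.

(** Integrate the pointwise inequality; nonnegative coefficients spare any discussion of
    integrability. *)
Lemma measure_indic_le (I J : finType) (b : I -> R) (c : J -> R)
    (B : I -> set X) (C : J -> set X) :
  (forall i, 0 <= b i) -> (forall j, 0 <= c j) ->
  (forall i, measurable (B i)) -> (forall j, measurable (C j)) ->
  (forall x, \sum_i b i * \1_(B i) x <= \sum_j c j * \1_(C j) x) ->
  \sum_i b i * fine (mu (B i)) <= \sum_j c j * fine (mu (C j)).
Proof.
move=> b0 c0 mB mC BC.
have E (K : finType) (a : K -> R) (A : K -> set X) : (forall i, 0 <= a i) ->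
    (forall i, measurable (A i)) ->
    (\int[mu]_x (\sum_i a i * \1_(A i) x)%:E)%E =
    (\sum_i a i * fine (mu (A i)))%:E.
  move=> a0 mA; under eq_integral do rewrite -sumEFin.
  rewrite ge0_integral_sum //; first last.
  - by move=> i x _; rewrite lee_fin mulr_ge0.
  - by move=> i; apply/measurable_EFinP; apply: measurable_funM.
  rewrite -sumEFin; apply: eq_bigr => i _.
  under eq_integral do rewrite EFinM.
  rewrite ge0_integralZl_EFin //; last exact/measurable_EFinP.
  by rewrite integral_indic // setIT EFinM fineK // fin_num_measure.
rewrite -lee_fin -!E //; apply: ge0_le_integral => //.
- by move=> x _; rewrite lee_fin sumr_ge0 // => i _; rewrite mulr_ge0.
- apply/measurable_EFinP; apply: measurable_sum => i.
  exact: measurable_funM.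
- apply/measurable_EFinP; apply: measurable_sum => i.
  exact: measurable_funM.
- by move=> x _; rewrite lee_fin.
Qed.

(* Integrate [(\sum_i \1_(W i) - m * a)^2 >= (m * a)^2 * \1_A0], which holds
   off the null set where [A0] meets some [W i]; the cross term is moved to the
   left and the null sets are added on the right so that all terms are
   nonnegative. *)
Lemma second_moment (m : nat) (W : 'I_m -> set X) (A0 : set X) (a e : R) :
  0 <= a -> 0 <= e -> measurable A0 -> (forall i, measurable (W i)) ->
  (forall i, mu (W i) = a%:E) ->
  (forall i j : 'I_m, (i < j)%N -> fine (mu (W i `&` W j)) <= a ^+ 2 + e) ->
  (forall i, mu (A0 `&` W i) = 0%E) ->
  m%:R ^+ 2 * a ^+ 2 * fine (mu A0) <= m%:R + m%:R ^+ 2 * e.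
Proof.
move=> a0 e0 mA0 mW Wa We A0W.
pose k := m%:R * a.
have k0 : 0 <= k by rewrite mulr_ge0.
(* With N the sum of the indicators of the [W i], whose mean is [k], these data encode 2kN + k^2
   1_A0 <= N^2 + k^2 V + k^2, where V sums the indicators of the null sets. *)
pose b (o : 'I_m + 'I_1) := if o is inl _ then k *+ 2 else k ^+ 2.
pose c (o : 'I_m * 'I_m + ('I_m + 'I_1)) := if o is inl _ then 1 else k ^+ 2.
pose B (o : 'I_m + 'I_1) := if o is inl i then W i else A0.
pose C (o : 'I_m * 'I_m + ('I_m + 'I_1)) := match o with
  | inl p => W p.1 `&` W p.2 | inr (inl i) => A0 `&` W i | inr (inr _) => setT end.
have b0 o : 0 <= b o by case: o => i; rewrite /b ?mulrn_wge0 ?sqr_ge0.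
have c0 o : 0 <= c o by case: o => i; rewrite /c ?sqr_ge0.
have mB o : measurable (B o) by case: o.
have mC o : measurable (C o) by case: o => [p|[i|i]] //=; exact: measurableI.
have BC x : \sum_o b o * \1_(B o) x <= \sum_o c o * \1_(C o) x.
  rewrite !big_sumType !big_ord1 /= indicT mulr1.
  under [X in _ <= X + _]eq_bigr do rewrite mul1r indicI.
  rewrite -(pair_bigA _ (fun i j => \1_(W i) x * \1_(W j) x)) /= -big_distrlr /=.
  rewrite -!mulr_sumr; set N := \sum_i \1_(W i) x.
  have V0 : 0 <= k ^+ 2 * \sum_i \1_(A0 `&` W i) x :> R.
    by rewrite mulr_ge0 ?sqr_ge0 // sumr_ge0.
  have [A0x|A0x] := boolP (x \in A0); last first.
    rewrite [\1_A0 x]indicE (negbTE A0x) mulr0 addr0.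
    have := sqr_ge0 (N - k). nra.
  have -> : \sum_i \1_(A0 `&` W i) x = N.
    by apply: eq_bigr => i _; rewrite indicI /= [\1_A0 x]indicE A0x mul1r.
  rewrite [\1_A0 x]indicE A0x mulr1.
  (* On [A0], either N = 0 and both sides are k^2, or the null term k^2 N already dominates k^2. *)
  have [->|N1] : N = 0 \/ 1 <= N; last first.
  - by have := sqr_ge0 (N - k); have := ler_peMr (sqr_ge0 k) N1; nra.
  - by rewrite !mulr0; nra.
  rewrite /N; under eq_bigr do rewrite indicE; rewrite -natr_sum.
  by case: (\sum_i _)%N => [|n]; [left|right; rewrite ler1n].
have := measure_indic_le b0 c0 mB mC BC.
rewrite !big_sumType !big_ord1 /= probability_setT mulr1.
under eq_bigr do rewrite Wa /=.
under [X in _ <= _ + (X + _)]eq_bigr do rewrite A0W /= mulr0.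
rewrite sumr_const card_ord big1_eq add0r.
have : \sum_(p : 'I_m * 'I_m) 1 * fine (mu (W p.1 `&` W p.2)) <=
    m%:R + m%:R ^+ 2 * (a ^+ 2 + e).
  rewrite -(pair_bigA _ (fun i j => 1 * fine (mu (W i `&` W j)))) /=.
  have -> : m%:R + m%:R ^+ 2 * (a ^+ 2 + e) =
      \sum_(i < m) (1 + m%:R * (a ^+ 2 + e)) :> R.
    by rewrite sumr_const card_ord -[RHS]mulr_natl; ring.
  apply: ler_sum => i _; rewrite (bigD1 i) //=; apply: lerD.
    by rewrite mul1r -lee_fin fineK ?fin_num_measure ?probability_le1 //; exact: measurableI.
  apply: (@le_trans _ _ (\sum_(j < m | j != i) (a ^+ 2 + e))).
    apply: ler_sum => j; rewrite mul1r neq_ltn => /orP[ji|ij]; last exact: We.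
    by rewrite setIC; exact: We.
  rewrite sumr_const -[leLHS]mulr_natl ler_wpM2r ?addr_ge0 ?sqr_ge0 // ler_nat.
  by rewrite -[leqRHS]card_ord max_card.
rewrite -(mulr_natl (k *+ 2 * a)) /k.
set s := \sum_p _; move: s => s sle.
nra.
Qed.
End SecondMoment.

(** * Times of null intersection in a weak mixing system *)

Section Transitions.
Context {R : realType} {d : measure_display} {X : measurableType d}.
Variables (mu : probability X R) (T : X -> X).

Lemma measure_preserving_iter n : measure_preserving mu T ->
  measure_preserving mu (iter n T).
Proof.
move=> [mT muT]; elim: n => [|n [mTn muTn]]; first by split=> //; exact: measurable_id.
split=> [|B mB]; first exact: (measurableT_comp mT mTn).
have -> : iter n.+1 T @^-1` B = iter n T @^-1` (T @^-1` B) by [].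
by rewrite muTn ?muT// -[_ @^-1` _]setTI; exact: mT.
Qed.

Lemma weak_mixing_not_J_set (A0 A1 : set X) (s t : nat) :
  weak_mixing mu T -> measurable A0 -> measurable A1 ->
  (0 < mu A0 * mu A1)%E -> 0 < t ->
  ~ J_set [set n | Npos n /\ mu (A0 `&` iter (s + t * n) T @^-1` A1) = 0%E].
Proof.
move=> [mpT wT] mA0 mA1 A01 t0 J.
have mT n B : measurable B -> measurable (iter n T @^-1` B).
  move=> mB; rewrite -[_ @^-1` _]setTI.
  by have [mTn _] := measure_preserving_iter n mpT; exact: mTn.
have muT n B : measurable B -> mu (iter n T @^-1` B) = mu B.
  exact: (measure_preserving_iter n mpT).2.
pose a := fine (mu A1); pose b := fine (mu A0).
have muA1 : mu A1 = a%:E by rewrite fineK // fin_num_measure.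
have muA0 : mu A0 = b%:E by rewrite fineK // fin_num_measure.
have a0 : (0 <= a)%R by rewrite -lee_fin -muA1 measure_ge0.
have b0 : (0 <= b)%R by rewrite -lee_fin -muA0 measure_ge0.
have ba0 : (0 < b * a)%R by move: A01; rewrite muA0 muA1 -EFinM lte_fin.
have aa0 : (0 < a)%R by rewrite lt0r a0 andbT; apply/eqP => E; rewrite E mulr0 ltxx in ba0.
pose e := (b * a ^+ 2 / 2)%R.
have ba20 : (0 < b * a ^+ 2)%R by rewrite expr2 mulrA mulr_gt0.
have e0 : (0 < e)%R by rewrite divr_gt0.
have [p [pb Kp pp]] := minimal_idempotent; have [pU pN] := pb.
pose D := [set n | Npos n /\
  (`| mu (A1 `&` iter n T @^-1` A1) - mu A1 * mu A1 | < e%:E)%E].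
(* Otherwise the complement of [D] in [Npos] would be central, [p] being a minimal idempotent, and
   the central-star set [D] would meet it. *)
have pD : p D.
  apply: contrapT => /(betaN_setC pb) pCD.
  have [_ /(_ (Npos `&` ~` D))] := wT e A1 A1 e0 mA1 mA1.
  case; last by move=> n [Dn [_ nDn]].
  split; first by move=> n [].
  by exists p; split=> //; exact: filterI.
have De n : D n -> (fine (mu (A1 `&` iter n T @^-1` A1)) <= a ^+ 2 + e)%R.
  move=> [_]; rewrite muA1; set c := mu _.
  have cf : c \is a fin_num by rewrite fin_num_measure //; apply: measurableI => //; exact: mT.
  rewrite -(fineK cf) -EFinM -EFinB /= lte_fin => /(le_lt_trans (ler_norm _)).
  by rewrite ltrBlDl expr2 => /ltW.
(* Since [e] is half of [b * a ^+ 2], the second moment bound amounts to m b a^2 <= 2, which this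
   [m] violates. *)
pose m := (Num.truncn (2 / (b * a ^+ 2))%R).+1.
have mbig : (2 < m%:R * (b * a ^+ 2))%R.
  rewrite -ltr_pdivrMr //; exact: truncnS_gt.
have [f [fN fD]] := difference_functions m pb pp pD t0.
have [|||c [H [c0 HP fJ]]] := J (range f).
- exact/finite_image/finite_finset.
- by exists (f ord0), ord0.
- by move=> _ [i _ <-].
(* Both [s] and [c] cancel in N j - N i = t dd, an element of [D]; so [c] and [H] may be chosen
   after [f]. *)
pose N i := s + t * (c + \sum_(n <- H) f i n).
have WiWj (i j : 'I_m) : i < j ->
    (fine (mu (iter (N i) T @^-1` A1 `&` iter (N j) T @^-1` A1)) <= a ^+ 2 + e)%R.
  move=> ij; have [dd [fji Ddd]] := fD H i j HP ij.
  have -> : iter (N i) T @^-1` A1 `&` iter (N j) T @^-1` A1 =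
      iter (N i) T @^-1` (A1 `&` iter (t * dd) T @^-1` A1).
    have NjE : N j = t * dd + N i by rewrite /N fji; ring.
    by rewrite NjE; apply/seteqP; split=> x; rewrite /= iterD.
  by rewrite muT; [exact: De|apply: measurableI => //; exact: mT].
have A0W i : mu (A0 `&` iter (N i) T @^-1` A1) = 0%E.
  by have [|_] := fJ (f i); first by exists i.
have WiA1 i : mu (iter (N i) T @^-1` A1) = a%:E by rewrite muT.
have := second_moment a0 (ltW e0) mA0 (fun i => mT (N i) _ mA1) WiA1 WiWj A0W.
rewrite -/b leNgt => /negP; apply.
have m0 : (0 < m%:R :> R)%R by rewrite ltr0n.
have := mbig; rewrite -(ltr_pM2l m0) /e; nra.
Qed.
End Transitions.

(** * Membership in [A] along progressions, and the sum subsystems *)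

(** Used with [t = 1] to extend sums and with [s = 0] to extend products. *)
Lemma dynamical_Cstar_affine (R : realType) (A : set nat) p s t :
  dynamical_Cstar R A -> JbetaN p -> 0 < t -> p [set n | A (s + t * n)].
Proof.
move=> [_ [d [X [mu [T [A0 [A1 [wmT mA0 mA1 A01 TA]]]]]]]] [pb pJ] t0.
have [pU pN] := pb.
have /(betaN_setC pb) pC :
    ~ p [set n | Npos n /\ mu (A0 `&` iter (s + t * n) T @^-1` A1) = 0%E].
  by move=> pS; apply: (weak_mixing_not_J_set (s := s) wmT mA0 mA1 A01 t0); apply: pJ pS => n [].
apply: filterS2 pN pC => n n0 nn; apply: TA; split.
  by rewrite /Npos /= addn_gt0 muln_gt0 t0 [0 < n]n0 orbT.
by rewrite lt0e measure_ge0 andbT; apply/eqP => E; apply: nn.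
Qed.

Theorem theorem3p4 (R : realType) (l : nat) (l_gt0 : 0 < l) (A : set nat)
    (A_Cstar : dynamical_Cstar R A) (x : 'I_l -> nat -> nat)
    (x_pos : forall i, set_fun Npos Npos (x i))
    (x_am : forall i, almost_minimal (x i)) :
  exists y : 'I_l -> nat -> nat,
    (forall i, sum_subsystem (x i) (y i)) /\ ZFS y `|` ZFP y `<=` A.
Proof.
have AN : A `<=` Npos by case: A_Cstar.
(* Each [i] has its own ultrafilter, so the choice is made for one [i] at a time, against lists of
   sums and products common to all [i]. *)
have step (c : nat * seq nat * seq nat * 'I_l) : exists H : {fset nat},
    let: (m, sums, prods, i) := c in
    [/\ Pf H, forall n, n \in H -> m < n,
        forall s, s \in sums -> A (\sum_(k <- H) x i k + s) &
        forall t, t \in prods -> 0 < t -> A ((\sum_(k <- H) x i k) * t)].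
  case: c => [[[m sums] prods] i]; have [p [/(_ m.+1 isT)[pb pFS] pJ]] := x_am i.
  have pU : UltraFilter p by case: pb.
  have pS : p [set n | forall s, s \in sums -> A (n + s)].
    apply: filter_forall_seq => s _.
    apply: filterS (dynamical_Cstar_affine s A_Cstar pJ (ltn0Sn 0)) => n.
    by rewrite /= mul1n addnC.
  have pP : p [set n | forall t, t \in prods -> 0 < t -> A (n * t)].
    apply: filter_forall_seq => t _; have [t0|t0] := posnP t.
      by apply: filterS filterT => n _; rewrite t0.
    apply: filterS (dynamical_Cstar_affine 0 A_Cstar pJ t0) => n /=.
    by rewrite mulnC.
  have [_ [[[H [PH mH] <-] HS] HP]] := filter_ex (filterI (filterI pFS pS) pP).
  by exists H.
have [g Hg] := choice step.
pose v c i := \sum_(k <- g (c, i)) x i k.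
(* The lists grow by the new terms of every [i], so a selection may switch sequences at each index;
   the bound exceeds no block's needs but covers all [i] at once. *)
pose next c := (\max_(i < l) \max_(k <- g (c, i)) k,
  c.1.2 ++ [seq v c i + s | i <- enum 'I_l, s <- c.1.2],
  c.2 ++ [seq v c i * t | i <- enum 'I_l, t <- c.2]).
(* The start is the empty sum and the empty product. Stage 0 also adds terms to the lists, which is
   harmless. *)
pose st n := iter n next (0, [:: 0], [:: 1]).
have stg n i : [/\ Pf (g (st n, i)), forall k, k \in g (st n, i) -> (st n).1.1 < k,
    forall s, s \in (st n).1.2 -> A (v (st n) i + s) &
    forall t, t \in (st n).2 -> 0 < t -> A (v (st n) i * t)].
  by have := Hg (st n, i); rewrite /v; case: (st n) => [[m sums] prods].
exists (fun i n => v (st n) i); split=> [i|].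
  exists (fun n => g (st n, i)) => n _; have [PH _ _ _] := stg n i; split=> // k j kH jH.
  have [_ /(_ j jH) + _ _] := stg n.+1 i; apply: leq_ltn_trans => /=.
  apply: (@leq_trans (\max_(q <- g (st n, i)) q)); first exact: leq_bigmax_seq.
  exact: (leq_bigmax (F := fun i => \max_(q <- g (st n, i)) q)).
have pos (H : {fset nat}) : Pf H -> all (leq 1) H /\ enum_fset H != [::].
  move=> [H0 HN]; split; first by apply/allP => k; exact: HN.
  by rewrite -size_eq0 cardfs_eq0.
move=> _ [|] [H [w [PH wy ->]]]; have [Hpos Hn0] := pos _ PH.
- apply: (big_uniq_mem (S := fun n => [set` (st n).1.2])) => //.
  + by move=> n s; rewrite /= mem_cat => ->.
  + move=> n s n0 sS; have [i ->] := wy n n0; have [_ _ AS _] := stg n i.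
    split; last exact: AS.
    rewrite /= mem_cat; apply/orP; right.
    by apply: allpairs_f => //; rewrite mem_enum.
  + exact: fset_uniq.
- apply: (big_uniq_mem (S := fun n => [set t | 0 < t /\ t \in (st n).2])) => //.
  + by move=> n t [t0]; rewrite /= mem_cat => ->.
  + move=> n t n0 [t0 tS]; have [i ->] := wy n n0; have [_ _ _ AP] := stg n i.
    (* Lying in [A], the new product is positive, so it can be multiplied again. *)
    have At := AP t tS t0; split=> //; split; first exact: AN.
    rewrite /= mem_cat; apply/orP; right.
    by apply: allpairs_f => //; rewrite mem_enum.
  + exact: fset_uniq.
Qed.
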